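(* Let $S$ be a numerical semigroup with cyclotomic exponent sequence $\mathbf e$. Then $\mathrm U(\mathrm{Betti}(S))=\mathrm U(\mathcal E(S))$, where both $\mathrm{Betti}(S)$ and $\mathcal E(S)$ are partially ordered by $\le_S$. Moreover, for every $b\in\mathrm U(\mathrm{Betti}(S))$ one has $e_b=\mathrm{nc}(\nabla_b)-1$.
   Context: A numerical semigroup $S$ is a submonoid of $(\mathbb N,+)$, $\mathbb N=\{0,1,2,\dots\}$, with $\mathbb N\setminus S$ finite; it has a unique minimal generating set $A=\{n_1,\dots,n_e\}$ (the minimal generators). The semigroup polynomial is $\mathrm P_S(x)=(1-x)\sum_{s\in S}x^s$, and the cyclotomic exponent sequence $\mathbf e=(e_j)_{j\ge1}$ is the unique integer sequence with $\mathrm P_S(x)=\prod_{j\ge1}(1-x^j)^{e_j}$ in $\mathbb Z[[x]]$. Set $\mathcal E(S)=\{d\in\mathbb N: d\ge2,\ e_d\neq0,\ d\notin A\}$. For $a,b\in\mathbb Z$ write $a\le_S b$ if $b-a\in S$ (a partial order). Let $\varphi:\mathbb N^e\to S$, $\varphi(a)=\sum_i a_in_i$; $\mathrm Z(s)=\varphi^{-1}(s)$ is the set of factorizations of $s\in S$. The graph $\nabla_s$ has vertex set $\mathrm Z(s)$, with distinct $x,y$ adjacent iff $x\cdot y\neq0$ (usual dot product). Its connected components are the $R$-classes of $s$, and $\mathrm{nc}(\nabla_s)$ is their number. $s$ is a Betti element if $\nabla_s$ is disconnected; $\mathrm{Betti}(S)$ is the set of Betti elements. For a poset $(X,\le)$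 and $x\in X$ let $\downarrow x=\{y\in X: y\le x\}$, and $\mathrm U(X)=\{x\in X:\ \downarrow x\text{ is totally ordered}\}$. *)

(* Defs.v *)
From mathcomp Require Import all_boot all_order all_algebra.
Unset Strict Implicit.
Unset Printing Implicit Defensive.
Import GRing.Theory Num.Theory.

Definition is_numerical_semigroup (S : nat -> bool) : Prop :=
  [/\ S 0, (forall a b, S a -> S b -> S (a + b)) & exists N, forall n, N <= n -> S n].

Definition is_mingen (S : nat -> bool) (n : nat) : bool :=
  [&& S n, 0 < n & ~~ [exists a : 'I_n, [&& 0 < (a : nat), S a & S (n - a)]]].

(* Factorizations of s: coefficient vectors indexed by the generator values
   (a minimal generator n > s necessarily has coefficient 0, and every coefficient
   is <= s, so 'I_s.+1 -> 'I_s.+1 loses nothing). *)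
Definition fact_type (s : nat) := {ffun 'I_s.+1 -> 'I_s.+1}.

Definition factorizations (S : nat -> bool) (s : nat) : {set fact_type s} :=
  [set x : fact_type s | [forall i : 'I_s.+1, ((x i : nat) != 0) ==> is_mingen S i]
                         && (\sum_(i < s.+1) (x i : nat) * i == s)].

Definition dotf {s : nat} (x y : fact_type s) : nat :=
  \sum_(i < s.+1) (x i : nat) * (y i : nat).

Definition nabla_rel (S : nat -> bool) (s : nat) : rel (fact_type s) :=
  fun x y => [&& x \in factorizations S s, y \in factorizations S s, x != y
               & dotf x y != 0].

Definition nc (S : nat -> bool) (s : nat) : nat :=
  n_comp (nabla_rel S s) (mem (factorizations S s)).

Definition betti (S : nat -> bool) (s : nat) : bool := 1 < nc S s.

(* truncation of P_S(x) = (1-x) sum_{s in S} x^s, correct up to degree N *)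
Local Open Scope ring_scope.
Definition semigroup_poly_trunc (S : nat -> bool) (N : nat) : {poly int} :=
  (1 - 'X) * \sum_(i < N.+1 | S i) 'X^i.

(* e is the cyclotomic exponent sequence: P_S = prod_{j>=1} (1-x^j)^{e_j} in Z[[x]].
   Equivalently (the factors being units of Z[[x]]), for every N, modulo x^{N+1}:
   P_S * prod_{j<=N, e_j<0} (1-x^j)^{-e_j} = prod_{j<=N, e_j>0} (1-x^j)^{e_j}. *)
Definition is_cyclotomic_exponents (S : nat -> bool) (e : nat -> int) : Prop :=
  forall N i, (i <= N)%N ->
    (semigroup_poly_trunc S N *
       \prod_(1 <= j < N.+1 | e j < 0) (1 - 'X^j) ^+ absz (e j))`_i
    = (\prod_(1 <= j < N.+1 | 0 < e j) (1 - 'X^j) ^+ absz (e j))`_i.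

Local Close Scope ring_scope.
Definition E_set (S : nat -> bool) (e : nat -> int) (d : nat) : bool :=
  [&& 2 <= d, e d != 0%R & ~~ is_mingen S d].

Definition leS (S : nat -> bool) (a b : nat) : bool := (a <= b) && S (b - a).

Definition U (S : nat -> bool) (X : nat -> bool) (x : nat) : Prop :=
  X x /\ forall y z, X y -> X z -> leS S y x -> leS S z x -> leS S y z \/ leS S z y.

(* Main.v *)
(* Let D(x) be the sum of |Z(s)| x^s, i.e. the product of the 1/(1 - x^n) over the
   minimal generators n, and write the sum of x^s over S as D(x) K(x) with
   K = prod_j (1 - x^j)^(g_j); then g_j = e_j for j >= 2 that is not a generator.
   Comparing coefficients of x^d gives the recursion
     g_d = [x^d] (D prod_(j < d) (1 - x^j)^(g_j)) - [d in S],
   whose factors with j not <=_S d do not contribute.  Hence g_d = 0 off S.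
   Suppose the Betti elements <=_S d form a chain with minimum b1, and fix a
   factorization u0 of b1.  The "reducers" are the isolated factorizations, other than
   u0, of the Betti elements b <_S d.  Their supports are pairwise disjoint, and b has
   exactly nc(b) - 1 of them because the non-isolated factorizations of b form at most
   one R-class.  By induction the coefficient above therefore counts the factorizations
   of d that lie above no reducer, and every R-class of d contains exactly one of these:
   g_d = nc(d) - 1.  The equality of the two U-sets follows formally. *)
Require Import Defs.
From mathcomp Require Import all_boot all_order all_algebra.
From mathcomp Require Import zify.
Import GRing.Theory Num.Theory.
Local Open Scope ring_scope.

Set Implicit Arguments.
Unset Strict Implicit.
Unset Printing Implicit Defensive.

(* [lia] is very slow in the presence of boolean atoms that are not arithmetic. *)
Ltac nlia :=
  repeat match goal with
  | H : ?P |- _ =>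
    lazymatch P with
    | is_true (leq _ _) => fail
    | @eq nat _ _ => fail
    | is_true (~~ (@eq_op _ (_ : nat) _)) => fail
    | _ => clear H
    end
  end; lia.

(** Each point of [A] is its own root, and all points of [a :\: A] share a single root, so the roots
    in [a] are [A] and at most one more point. *)
Lemma n_comp_isolated (T : finType) (r : rel T) (a A : {set T}) :
    connect_sym r -> closed r (mem a) -> A \subset a ->
    (forall x y, x \in A -> connect r x y -> y = x) ->
    (forall x y, x \in a :\: A -> y \in a :\: A -> connect r x y) ->
  n_comp r (mem a) = (#|A| + (a :\: A != set0))%N.
Proof.
move=> rsym acl sAa isoA conA; rewrite /n_comp_mem.
have rootA x : x \in A -> fingraph.root r x = x.
  by move=> xA; apply: isoA xA _; exact: connect_root.
have rootD x : x \in a :\: A -> fingraph.root r x \in a :\: A.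
  rewrite !inE => /andP[xA xa].
  rewrite -(closed_connect acl (connect_root r x)) xa andbT.
  apply: contra xA => rA; suff -> : x = fingraph.root r x by [].
  by apply: isoA rA _; rewrite rsym connect_root.
have [D0|[x xD]] := set_0Vmem (a :\: A).
  rewrite D0 eqxx addn0; apply: eq_card => y; rewrite !inE.
  have -> : (y \in a) = (y \in A).
    apply/idP/idP=> [ya|/(subsetP sAa)//].
    by apply: contraT => yA; have := in_set0 y; rewrite -D0 inE yA ya.
  case yA: (y \in A); rewrite ?andbF // andbT.
  by rewrite /roots /= rootA // eqxx.
have -> : a :\: A != set0 by apply/set0Pn; exists x.
rewrite addn1; have rx := rootD _ xD.
have rxA : fingraph.root r x \notin A by move: rx; rewrite inE => /andP[].
transitivity #|fingraph.root r x |: A|; last by rewrite cardsU1 rxA.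
apply: eq_card => y; rewrite !inE.
have [->|ne] := eqVneq y (fingraph.root r x).
  by rewrite /= roots_root //; move: rx; rewrite inE => /andP[_ ->].
case yA: (y \in A) => /=.
  by rewrite (subsetP sAa) // andbT /roots /= rootA // eqxx.
case ya: (y \in a); rewrite ?andbF // andbT.
apply/negbTE; apply: contra ne => /eqP <-; apply/eqP.
by apply/(fingraph.rootP rsym); apply: conA; rewrite // inE yA ya.
Qed.

(** * Factorizations as vectors of a common length, and their R-classes *)

Section Factorizations.
Local Open Scope nat_scope.
Variables (S : nat -> bool) (N : nat).

(** The length does not depend on the factored element, so factorizations of different elements can
    be added and compared, which [fact_type s] does not allow. *)
Definition vec := {ffun 'I_N.+1 -> nat}.
Definition vadd (x y : vec) : vec := [ffun i => x i + y i].
Definition vsub (x y : vec) : vec := [ffun i => x i - y i].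
Definition vle (x y : vec) := [forall i, x i <= y i].
Definition meets (x y : vec) := [exists i, (x i != 0) && (y i != 0)].
Definition wt (x : vec) := \sum_(i < N.+1) x i * i.
Definition is_fact s (x : vec) :=
  [forall i, (x i != 0) ==> is_mingen S i] && (wt x == s).

Lemma vleP (x y : vec) : reflect (forall i, x i <= y i) (vle x y).
Proof. exact: forallP. Qed.

Lemma meetsP (x y : vec) : reflect (exists i, x i != 0 /\ y i != 0) (meets x y).
Proof.
apply: (iffP existsP) => -[i]; first by case/andP=> ? ?; exists i.
by case=> xi yi; exists i; apply/andP.
Qed.

Lemma meetsC (x y : vec) : meets x y = meets y x.
Proof. by apply: eq_existsb => i; rewrite andbC. Qed.

Lemma is_factP s (x : vec) :
  reflect ((forall i, x i != 0 -> is_mingen S i) /\ wt x = s) (is_fact s x).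
Proof.
apply: (iffP andP) => -[h /eqP e]; split=> //.
  by move=> i; apply/implyP; move/forallP: h.
by apply/forallP => i; apply/implyP; exact: h.
Qed.

Lemma vaddC x y : vadd x y = vadd y x.
Proof. by apply/ffunP => i; rewrite !ffunE addnC. Qed.

Lemma vaddI x : injective (vadd x).
Proof.
by move=> y z /ffunP e; apply/ffunP => i; have := e i; rewrite !ffunE => /addnI.
Qed.

Lemma vsubK x y : vle x y -> vadd x (vsub y x) = y.
Proof. by move/vleP => le; apply/ffunP => i; rewrite !ffunE subnKC. Qed.

Lemma vle_addr x y : vle x (vadd x y).
Proof. by apply/vleP => i; rewrite ffunE leq_addr. Qed.

Lemma vle_trans y x z : vle x y -> vle y z -> vle x z.
Proof.
by move=> /vleP a /vleP b; apply/vleP => i; exact: leq_trans (a i) (b i).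
Qed.

Lemma wtD x y : wt (vadd x y) = wt x + wt y.
Proof.
by rewrite /wt -big_split; apply: eq_bigr => i _; rewrite ffunE mulnDl.
Qed.

Lemma is_factD s t x y : is_fact s x -> is_fact t y -> is_fact (s + t) (vadd x y).
Proof.
move=> /is_factP[hx <-] /is_factP[hy <-]; apply/is_factP; split; last exact: wtD.
move=> i; rewrite ffunE addn_eq0 negb_and => /orP[/hx|/hy]//.
Qed.

Lemma is_fact_sub s x y : is_fact s y -> vle x y ->
  is_fact (wt x) x /\ is_fact (s - wt x) (vsub y x).
Proof.
move=> /is_factP[hy ey] lexy.
have e : wt x + wt (vsub y x) = s by rewrite -wtD vsubK.
split; apply/is_factP; split=> //.
- move=> i xi; apply: hy; move/vleP: lexy => /(_ i).
  by case: (y i) xi => // /negbTE; case: (x i).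
- by move=> i; rewrite ffunE => xi; apply: hy; apply: contra xi => /eqP->.
- by rewrite -e addKn.
Qed.

Lemma is_fact_wt_gt0 s x i : is_fact s x -> x i != 0 -> 0 < i.
Proof. by case/is_factP=> hx _ /hx /and3P[]. Qed.

Lemma leq_wt (x : vec) i : x i * i <= wt x.
Proof. by rewrite /wt (bigD1 i) //= leq_addr. Qed.

Lemma is_fact_pos s x : is_fact s x -> 0 < s -> exists i, x i != 0.
Proof.
case/is_factP=> _ <- s0; apply/existsP; apply: contraLR s0.
rewrite negb_exists => /forallP x0; rewrite -leqNgt /wt big1 // => i _.
by have /negPn/eqP-> := x0 i.
Qed.

Lemma is_fact_gt0 s x i : is_fact s x -> x i != 0 -> 0 < s.
Proof.
move=> fx xi; have i0 := is_fact_wt_gt0 fx xi; case/is_factP: fx => _ <-.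
by apply: leq_trans (leq_wt x i); rewrite muln_gt0 lt0n xi.
Qed.

(** Padding with zeros. For [s <= N] it identifies the factorizations in [fact_type s] with the
    vectors satisfying [is_fact s]. *)
Definition ext s (y : fact_type s) : vec :=
  [ffun i : 'I_N.+1 => if insub (i : nat) is Some k then y k : nat else 0].
Definition Z s : seq vec := [seq ext y | y in factorizations S s].

Section Fixed.
Variable s : nat.
Hypothesis sN : s <= N.

Let inN (k : 'I_s.+1) : 'I_N.+1 := widen_ord (sN : s.+1 <= N.+1) k.

Lemma ext_widen (y : fact_type s) k : ext y (inN k) = y k.
Proof. by rewrite ffunE valK. Qed.

Lemma ext_neq0 (y : fact_type s) i : ext y i != 0 -> exists k, i = inN k.
Proof.
by rewrite ffunE; case: insubP => [k _ e _|//]; exists k; apply: val_inj.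
Qed.

Lemma ext_inj : injective (@ext s).
Proof.
move=> y z e; apply/ffunP => k; apply: val_inj.
by rewrite /= -!ext_widen e.
Qed.

Lemma wt_ext (y : fact_type s) : wt (ext y) = \sum_(k < s.+1) y k * k.
Proof.
pose f n := (if insub n is Some k then y k : nat else 0) * n.
rewrite /wt (eq_bigr (fun i : 'I_N.+1 => f i)); last by move=> i _; rewrite ffunE.
rewrite [RHS](eq_bigr (fun k : 'I_s.+1 => f k)); last by move=> i _; rewrite /f valK.
rewrite [RHS](big_ord_widen N.+1 f) // [LHS](bigID (fun i : 'I_N.+1 => i < s.+1)) /=.
rewrite [X in _ + X]big1 ?addn0 // => i.
by rewrite /f; case: insubP => // k ->.
Qed.

Lemma is_fact_ext (y : fact_type s) : is_fact s (ext y) = (y \in factorizations S s).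
Proof.
rewrite inE /is_fact wt_ext; congr (_ && _).
apply/forallP/forallP => h i.
  by have := h (inN i); rewrite ext_widen.
apply/implyP => yi; have [k ek] := ext_neq0 yi.
by move: yi (h k); rewrite ek ext_widen => -> /=.
Qed.

(** If [x i] is nonzero, then [x i * i <= s] with both factors positive; so index and coefficient
    are at most [s], and [x] fits into [fact_type s]. *)
Lemma is_fact_exists x : is_fact s x ->
  exists2 y : fact_type s, y \in factorizations S s & ext y = x.
Proof.
move=> fx; have [hx ex] := is_factP _ _ fx.
have xle i : x i <= s /\ (x i != 0 -> i <= s).
  have [->|xi] := eqVneq (x i) 0; first by [].
  have i0 := is_fact_wt_gt0 fx xi; have := leq_wt x i; rewrite ex => le.
  split; first exact: leq_trans (leq_pmulr _ i0) le.
  by move=> _; apply: leq_trans le; apply: leq_pmull; rewrite lt0n.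
pose y : fact_type s := [ffun k => inord (x (inN k))].
suff ey : ext y = x by exists y; rewrite -?is_fact_ext ?ey.
apply/ffunP => i; rewrite ffunE; case: insubP => [k _ ek|].
  rewrite ffunE inordK; last by rewrite ltnS; case: (xle (inN k)).
  by congr (x _); apply: val_inj; rewrite /= ek.
rewrite ltnS => /negP ne; apply/esym/eqP; apply: contraT => xi.
by case: (xle i) => _ /(_ xi) /ne.
Qed.

Lemma mem_Z x : (x \in Z s) = is_fact s x.
Proof.
apply/imageP/idP => [[y yf ->]|/is_fact_exists[y yf <-]]; last by exists y.
by rewrite is_fact_ext.
Qed.

Lemma Z_uniq : uniq (Z s).
Proof. by rewrite map_inj_uniq ?enum_uniq //; exact: ext_inj. Qed.

Lemma dotf_ext (y z : fact_type s) : (dotf y z != 0) = meets (ext y) (ext z).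
Proof.
rewrite /dotf sum_nat_eq0 negb_forall; apply/existsP/existsP => -[i].
  by rewrite /= muln_eq0 negb_or => h; exists (inN i); rewrite !ext_widen.
case/andP=> yi; have [k ek] := ext_neq0 yi; rewrite ek !ext_widen in yi * => zk.
by exists k; rewrite /= muln_eq0 negb_or yi.
Qed.

Lemma nabla_sym : symmetric (nabla_rel S s).
Proof.
move=> y z; rewrite /nabla_rel eq_sym !dotf_ext meetsC.
by rewrite !andbA; congr (_ && _ && _); rewrite andbC.
Qed.

Lemma nabla_closed : closed (nabla_rel S s) (mem (factorizations S s)).
Proof. by move=> y z /and4P[] /= -> ->. Qed.

Lemma meets_connect (y z : fact_type s) :
    y \in factorizations S s -> z \in factorizations S s ->
    meets (ext y) (ext z) -> connect (nabla_rel S s) y z.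
Proof.
move=> yf zf m; have [->|ne] := eqVneq y z; first exact: connect0.
by apply: connect1; rewrite /nabla_rel yf zf ne dotf_ext.
Qed.

(** For a factorization [x] of [s] this says that [x] alone is an R-class. *)
Definition isolated (x : vec) := all (fun y => (y == x) || ~~ meets x y) (Z s).

Lemma isolatedP x :
  reflect (forall y, is_fact s y -> meets x y -> y = x) (isolated x).
Proof.
apply: (iffP allP) => h y.
  by rewrite -mem_Z => /h /orP[/eqP//|/negbTE->].
by rewrite mem_Z => /h {}h; case m: (meets x y); rewrite ?orbT // (h m) eqxx.
Qed.

Lemma not_isolated x : ~~ isolated x ->
  exists y, [/\ is_fact s y, meets x y & y != x].
Proof.
case/allPn=> y; rewrite mem_Z negb_or negbK => fy /andP[ne m]; exists y.
by split.
Qed.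

Lemma isolated_connect (y z : fact_type s) :
  isolated (ext y) -> connect (nabla_rel S s) y z -> z = y.
Proof.
move=> /isolatedP iso /connectP[p].
elim: p => [_ ->//|w p IH] /= /andP[/and4P[yf wf ne d] pth] ez.
have /eqP : ext w = ext y by apply: iso; rewrite ?is_fact_ext // -dotf_ext.
by rewrite (inj_eq ext_inj) eq_sym (negbTE ne).
Qed.

Lemma isolated_betti x y :
  is_fact s x -> is_fact s y -> y != x -> isolated x -> betti S s.
Proof.
move=> /is_fact_exists[a af <-] /is_fact_exists[b bf <-]; rewrite (inj_eq ext_inj).
move=> ne iso; have csym := sym_connect_sym nabla_sym.
have ra c : c \in factorizations S s ->
  fingraph.root (nabla_rel S s) c \in predI (roots (nabla_rel S s)) (mem (factorizations S s)).
  move=> cf; rewrite inE /= roots_root //=.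
  by have := closed_connect nabla_closed (connect_root (nabla_rel S s) c) => /= <-.
apply/card_gt1P; exists (fingraph.root (nabla_rel S s) a), (fingraph.root (nabla_rel S s) b).
split; rewrite ?ra //; apply: contra ne => /eqP/(fingraph.rootP csym) c.
by rewrite (isolated_connect iso c).
Qed.

(** [z] serves as a hub: each non-isolated factorization reaches it through some [y], so together
    they form at most one R-class. *)
Lemma nc_isolated z :
    (forall x, is_fact s x -> ~~ isolated x -> is_fact s z /\
       exists y, [/\ is_fact s y, meets x y & meets y z]) ->
  nc S s = count isolated (Z s) + has (predC isolated) (Z s).
Proof.
move=> hz; have csym := sym_connect_sym nabla_sym.
set A := [set y in factorizations S s | isolated (ext y)].
have inA y : (y \in A) = (y \in factorizations S s) && isolated (ext y).
  by rewrite in_set.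
have inD y : (y \in factorizations S s :\: A) =
    (y \in factorizations S s) && ~~ isolated (ext y).
  by rewrite in_setD inA; case: (y \in _) => /=; rewrite ?andbT ?andbF.
rewrite /nc (@n_comp_isolated _ _ _ A) //.
- congr (_ + _); first last.
    congr (nat_of_bool _); apply/set0Pn/hasP => -[y].
      by rewrite inD => /andP[yf iy]; exists (ext y); rewrite ?mem_Z ?is_fact_ext.
    rewrite mem_Z => /is_fact_exists[w wf <-] iso; exists w.
    by rewrite inD wf.
  rewrite cardE /Z count_map -size_filter; apply/perm_size/uniq_perm.
  - exact: enum_uniq.
  - by rewrite filter_uniq // enum_uniq.
  - by move=> y; rewrite [RHS]mem_filter !mem_enum inA andbC.
- exact: nabla_closed.
- by apply/subsetP => y; rewrite inA => /andP[].
- by move=> y w; rewrite inA => /andP[_] /isolated_connect; exact.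
have conz w y : w \in factorizations S s :\: A -> ext y = z ->
    connect (nabla_rel S s) w y.
  rewrite inD => /andP[wf iw] ey.
  have [|fz [v [fv m1 m2]]] := hz (ext w) _ iw; first by rewrite is_fact_ext.
  have [v' vf ev] := is_fact_exists fv; apply: (@connect_trans _ _ v').
    by apply: meets_connect; rewrite // ev.
  by apply: meets_connect; rewrite // ?ev -?is_fact_ext ey.
move=> x y xD yD.
have [xf ix] : (x \in factorizations S s) /\ ~~ isolated (ext x).
  by apply/andP; rewrite -inD.
have [|fz _] := hz (ext x) _ ix; first by rewrite is_fact_ext.
have [w _ ew] := is_fact_exists fz.
by apply: connect_trans (conz _ _ xD ew) _; rewrite csym; exact: conz.
Qed.

End Fixed.

End Factorizations.

Lemma pairwise_in_uniq (T : eqType) (r : rel T) (s : seq T) :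
  uniq s -> {in s &, forall x y, x != y -> r x y} -> pairwise r s.
Proof.
elim: s => //= x s IH /andP[xs us] h; apply/andP; split.
  apply/allP => y ys; apply: h; rewrite ?inE ?eqxx ?ys ?orbT //.
  by apply: contraNneq xs => ->.
by apply: IH => // y z ys zs; apply: h; rewrite inE ?ys ?zs orbT.
Qed.

(** * Betti elements below [N], reducers, and the count of R-classes *)

Section LocalCount.
Local Open Scope nat_scope.
Variables (S : nat -> bool) (N : nat).
Hypotheses (S0 : S 0) (SD : forall a b, S a -> S b -> S (a + b)).

Implicit Types x y u v w : vec N.

Lemma leS_leq a b : leS S a b -> a <= b. Proof. by case/andP. Qed.

Lemma leS_refl a : leS S a a. Proof. by rewrite /leS leqnn subnn. Qed.

Lemma leS_trans b a c : leS S a b -> leS S b c -> leS S a c.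
Proof.
move=> /andP[ab Sab] /andP[bc Sbc]; rewrite /leS (leq_trans ab bc) /=.
by rewrite (_ : c - a = (b - a) + (c - b)); [exact: SD|nlia].
Qed.

Lemma is_fact_S s x : is_fact S s x -> S s.
Proof.
case/is_factP=> hx <-; rewrite /wt; apply: (big_ind (fun n => S n) S0 SD) => i _.
have [->//|/hx/and3P[Si _ _]] := eqVneq (x i) 0.
by elim: (x i) => [|n IH] //; rewrite mulSn; exact: SD.
Qed.

Definition unitv (i : 'I_N.+1) : vec N := [ffun k => (k == i) : nat].

Lemma wt_unitv (i : 'I_N.+1) : wt (unitv i) = i.
Proof.
rewrite /wt (bigD1 i) //= ffunE eqxx mul1n big1 ?addn0 // => k ki.
by rewrite ffunE (negbTE ki).
Qed.

Lemma vle_unitv i x : vle (unitv i) x = (x i != 0).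
Proof.
apply/vleP/idP => [/(_ i)|xi k]; first by rewrite ffunE eqxx lt0n.
by rewrite ffunE; case: (eqVneq k i) => [->|//]; rewrite lt0n.
Qed.

Lemma is_fact_unitv (i : 'I_N.+1) : is_mingen S i -> is_fact S i (unitv i).
Proof.
move=> hi; apply/is_factP; split; last exact: wt_unitv.
by move=> k; rewrite ffunE; case: (eqVneq k i) => [->|].
Qed.

Lemma is_fact0 x : is_fact S 0 x = (x == [ffun=> 0]).
Proof.
apply/idP/eqP => [fx|->].
  apply/ffunP => i; rewrite ffunE; apply/eqP; apply: contraT => xi.
  by have := is_fact_gt0 fx xi.
apply/is_factP; split; first by move=> i; rewrite ffunE.
by rewrite /wt big1 // => i _; rewrite ffunE.
Qed.

Lemma fact_exists s : s <= N -> S s -> exists x, is_fact S s x.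
Proof.
elim/ltn_ind: s => s IH sN Ss.
have [->|s0] := posnP s; first by exists [ffun=> 0]; rewrite is_fact0.
have [ms|] := boolP (is_mingen S s).
  by exists (unitv (Ordinal (sN : s < N.+1))); exact: is_fact_unitv.
rewrite /is_mingen Ss s0 /= negbK => /existsP[a /and3P[a0 Sa Sb]].
have [] := IH a _ _ Sa => //; first by apply: ltnW; apply: leq_trans sN.
move=> x fx; have [] := IH (s - a) _ _ Sb; rewrite ?leq_subLR; try nlia.
move=> y fy; exists (vadd x y).
by rewrite -(subnKC (ltnW (ltn_ord a))); exact: is_factD.
Qed.

Lemma vle_wt x y : vle x y -> wt x <= wt y.
Proof. by move=> /vsubK <-; rewrite wtD leq_addr. Qed.

Lemma vle_wt_eq s w x : is_fact S s x -> vle w x -> wt w = s -> w = x.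
Proof.
move=> fx le ew; have [_] := is_fact_sub fx le.
rewrite ew subnn is_fact0 => /eqP e; rewrite -(vsubK le) e.
by apply/ffunP => i; rewrite !ffunE addn0.
Qed.

Lemma vle_leS s w x : is_fact S s x -> vle w x -> leS S (wt w) s.
Proof.
move=> fx le; have [_ /is_fact_S] := is_fact_sub fx le; rewrite /leS => ->.
by case/is_factP: fx => _ <-; rewrite vle_wt.
Qed.

(** If [x] is not isolated, it shares a generator [i] with another factorization [z]. Removing [i]
    from both leaves two distinct factorizations of [s - i], and the descent continues until an
    isolated one is met. *)
Lemma isolated_below s x y : s <= N -> is_fact S s x -> is_fact S s y -> y != x ->
  exists w, [/\ vle w x, isolated S (wt w) w & betti S (wt w)].
Proof.
elim/ltn_ind: s x y => s IH x y sN fx fy ne.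
have ex : wt x = s by case/is_factP: fx.
have [iso|] := boolP (isolated S s x).
  exists x; rewrite ex; split=> //; last exact: isolated_betti fx fy ne iso.
  by apply/vleP.
case/(not_isolated sN) => z [fz /meetsP[i [xi zi]] nez].
have lx : vle (unitv i) x by rewrite vle_unitv.
have lz : vle (unitv i) z by rewrite vle_unitv.
have [_] := is_fact_sub fx lx; have [_] := is_fact_sub fz lz.
rewrite wt_unitv => fz' fx'.
have i0 := is_fact_wt_gt0 fx xi.
have s0 := is_fact_gt0 fx xi.
have [|||w [lw iw bw]] := IH (s - i) _ _ _ _ fx' fz'; try nlia.
  by apply: contra nez => /eqP e; rewrite -(vsubK lx) -(vsubK lz) e.
exists w; split=> //; apply: vle_trans lw _.
by apply/vleP => k; rewrite ffunE leq_subr.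
Qed.

Lemma betti_facts b x : b <= N -> betti S b -> exists2 y, is_fact S b y & y != x.
Proof.
move=> bN /card_gt1P[y [z [/andP[_ yf] /andP[_ zf] ne]]].
have [e|] := eqVneq (ext N y) x; last by exists (ext N y); rewrite ?is_fact_ext.
exists (ext N z); first by rewrite is_fact_ext.
by rewrite -e (inj_eq (ext_inj bN)) eq_sym.
Qed.

Lemma betti_S b : b <= N -> betti S b -> S b.
Proof. by move=> bN /(betti_facts [ffun=> 0] bN) [y /is_fact_S]. Qed.

Lemma betti_gt0 b : b <= N -> betti S b -> 0 < b.
Proof.
move=> bN bb; rewrite lt0n; apply: contraTN bb => /eqP ->; apply/negP.
by case/(betti_facts [ffun=> 0] (leq0n N)) => y; rewrite is_fact0 => ->.
Qed.

(** The Betti element [b] has a factorization other than [u]; exchanging [u] for it gives a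
    different factorization of [s] that still contains the nonzero [y]. *)
Lemma isolated_swap s b c u y : s <= N -> s = b + c -> 0 < c -> betti S b ->
  is_fact S c y -> ~~ isolated S s (vadd u y).
Proof.
move=> sN es c0 bb fy; have bN : b <= N by nlia.
have [u' fu' ne] := betti_facts u bN bb; apply/negP => /(isolatedP _ sN).
have [i yi] := is_fact_pos fy c0.
have fu'y : is_fact S s (vadd u' y) by rewrite es; exact: is_factD.
move/(_ _ fu'y) => e.
suff : vadd y u' = vadd y u by move/vaddI/eqP; rewrite (negbTE ne).
rewrite !(vaddC y); apply: e; apply/meetsP; exists i.
by rewrite !ffunE !addn_eq0 !(negbTE yi) !andbF.
Qed.

(** If they met, then [vadd u y], with [y] a factorization of [b' - b], would meet the isolated [u']
    and hence equal it, against [isolated_swap]. *)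
Lemma isolated_disjoint b b' u u' : b' <= N -> leS S b b' -> b < b' -> betti S b ->
  is_fact S b u -> is_fact S b' u' -> isolated S b' u' -> ~~ meets u u'.
Proof.
move=> b'N /andP[le Sb] lt bb fu fu' iso.
have [|y fy] := fact_exists _ Sb; first by nlia.
apply/negP => /meetsP[i [ui u'i]]; have c0 : 0 < b' - b by nlia.
have := @isolated_swap b' b (b' - b) u y b'N (esym (subnKC le)) c0 bb fy.
move/(isolatedP _ b'N): (iso) => /(_ (vadd u y)) ->; first by rewrite iso.
  by rewrite -(subnKC le); exact: is_factD.
by apply/meetsP; exists i; rewrite ffunE addn_eq0 (negbTE ui).
Qed.

(* Below [N] the Betti elements form a chain with least element [b1]; [u0] is a
   chosen factorization of [b1].  When no Betti element is strictly below [N] the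
   hypothesis [b1_least] is vacuous and [b1], [u0] are arbitrary. *)
Variables (b1 : nat) (u0 : vec N).
Hypothesis b1_least : forall b, betti S b -> leS S b N -> b < N ->
  [/\ leS S b1 b, is_fact S b1 u0 & betti S b1].
Hypothesis betti_chain : forall b c, betti S b -> betti S c ->
  leS S b N -> leS S c N -> leS S b c \/ leS S c b.

Lemma not_isolated_below b x : leS S b N -> is_fact S b x -> ~~ isolated S b x ->
  exists w, [/\ vle w x, wt w < b, leS S (wt w) b, isolated S (wt w) w & betti S (wt w)].
Proof.
move=> bN fx iso; have leb := leS_leq bN; have [y [fy _ ne]] := not_isolated leb iso.
have [w [lw iw bw]] := isolated_below leb fx fy ne; exists w.
have lewb := vle_leS fx lw; split=> //; rewrite ltn_neqAle leS_leq // andbT.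
by apply: contra iso => /eqP e; rewrite -(vle_wt_eq fx lw e) -e.
Qed.

(** This provides the hub for [nc_isolated]: any [vadd u0 v] will do. *)
Lemma not_isolated_b1 b x : leS S b N -> is_fact S b x -> ~~ isolated S b x ->
  [/\ b1 < b, leS S b1 b, is_fact S b1 u0, betti S b1 &
   forall v, is_fact S (b - b1) v -> is_fact S b (vadd u0 v) /\
     exists y, [/\ is_fact S b y, meets x y & meets y (vadd u0 v)]].
Proof.
move=> bN fx iso; have [w [lw ltw lewb iw bw]] := not_isolated_below bN fx iso.
have lewN := leS_trans lewb bN; have leb := leS_leq bN.
have [|le1w fu0 bb1] := b1_least bw lewN; first by nlia.
have le1 := leS_leq le1w; split=> //; first by nlia.
  exact: leS_trans le1w lewb.
move=> v fv; have [_ fxw] := is_fact_sub fx lw.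
split; first by rewrite (_ : b = b1 + (b - b1)); [exact: is_factD|nlia].
have [||v' fv'] := @fact_exists (wt w - b1); first by nlia.
  by case/andP: le1w.
(* The part [w] of [x] is exchanged for a factorization of [wt w] that contains [u0]. The remainder
   of [x] is then shared with [x], and [u0] with the hub. *)
exists (vadd (vsub x w) (vadd u0 v')); split.
- have -> : b = (b - wt w) + (b1 + (wt w - b1)) by nlia.
  by do 2!apply: is_factD => //.
- have [|i xi] := is_fact_pos fxw; first by nlia.
  apply/meetsP; exists i; rewrite !ffunE; move: xi; rewrite ffunE => xi.
  by split; nlia.
- have [|i xi] := is_fact_pos fu0; first by apply: betti_gt0 => //; nlia.
  by apply/meetsP; exists i; rewrite !ffunE; split; nlia.
Qed.

Lemma nc_count b : leS S b N ->
  nc S b = count (isolated S b) (Z S N b) + has (predC (isolated S b)) (Z S N b).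
Proof.
move=> bN; have leb := leS_leq bN.
have [/hasP[x]|no] := boolP (has (predC (isolated S b)) (Z S N b)); last first.
  (* Without non-isolated factorizations the hub condition is vacuous, and [u0] is a placeholder. *)
  rewrite (@nc_isolated _ _ _ leb u0) ?(negbTE no) // => x fx iso.
  by case/hasP: no; exists x; rewrite ?mem_Z.
rewrite mem_Z // => fx iso; have [lt le1 _ _ _] := not_isolated_b1 bN fx iso.
have [||v fv] := @fact_exists (b - b1); first by nlia.
  by case/andP: le1.
rewrite (@nc_isolated _ _ _ leb (vadd u0 v)); last first.
  by move=> y fy /(not_isolated_b1 bN fy) [_ _ _ _]; exact.
by congr (_ + nat_of_bool _); apply/hasP; exists x; rewrite ?mem_Z.
Qed.

Definition reducers_at b : seq (vec N) :=
  if betti S b && leS S b N then [seq u <- Z S N b | isolated S b u && (u != u0)]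
  else [::].
Definition reducers n := flatten [seq reducers_at b | b <- index_iota 1 n].

Lemma mem_reducers_at b u : u \in reducers_at b ->
  [/\ betti S b, leS S b N, is_fact S b u, isolated S b u & u != u0].
Proof.
rewrite /reducers_at; case: ifP => // /andP[bb le].
by rewrite mem_filter mem_Z ?leS_leq // => /andP[/andP[]].
Qed.

Lemma mem_reducers n u : u \in reducers n -> wt u < n /\ u \in reducers_at (wt u).
Proof.
case/flatten_mapP=> b; rewrite mem_index_iota => /andP[_ lt] ub.
have [_ _ /is_factP[_ ->]] := mem_reducers_at ub; by split.
Qed.

Lemma reducers_mem u : u != u0 -> betti S (wt u) -> leS S (wt u) N ->
  is_fact S (wt u) u -> isolated S (wt u) u -> wt u < N -> u \in reducers N.
Proof.
move=> ne bu leu fu iu lt; apply/flatten_mapP; exists (wt u).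
  by rewrite mem_index_iota lt betti_gt0 // leS_leq.
by rewrite /reducers_at bu leu mem_filter iu ne mem_Z ?leS_leq.
Qed.

Lemma reducers_at_disjoint b c u v : b < c -> u \in reducers_at b ->
  v \in reducers_at c -> ~~ meets u v.
Proof.
move=> lt /mem_reducers_at[bb leb fu iu _] /mem_reducers_at[bc lec fv iv _].
apply: (@isolated_disjoint b c) => //; first exact: leS_leq.
by case: (betti_chain bb bc leb lec) => // /leS_leq; nlia.
Qed.

(** For different weights the chain condition and [isolated_disjoint] apply; two distinct isolated
    factorizations of one element cannot meet either. *)
Lemma reducers_pairwise n : pairwise (fun u v => ~~ meets u v) (reducers n).
Proof.
rewrite /reducers /index_iota; move: (n - 1) => m.
move: 1 => k; elim: m k => //= m IH k.
rewrite pairwise_cat IH andbT; apply/andP; split.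
  apply/allrelP => u v uk /flatten_mapP[c]; rewrite mem_iota => /andP[lt _].
  exact: (reducers_at_disjoint lt uk).
apply: pairwise_in_uniq.
  by rewrite /reducers_at; case: ifP => // /andP[_ le]; rewrite filter_uniq ?Z_uniq ?leS_leq.
move=> u v /mem_reducers_at[_ le fu iu _] /mem_reducers_at[_ _ fv _ _] ne.
apply: contraNN ne; rewrite eq_sym; have leN := leS_leq le.
by move/(isolatedP _ leN): iu => /(_ _ fv) h /h ->.
Qed.

(** Exactly one class of a Betti element gives no reducer: at [b1] all factorizations are isolated
    and [u0] is left out, while above [b1] it is the class of the non-isolated ones. For other
    elements the truncated difference [nc S b - 1] is zero. *)
Lemma size_reducers_at b : b < N ->
  size (reducers_at b) = if leS S b N then nc S b - 1 else 0.
Proof.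
move=> lt; rewrite /reducers_at; case: ifP => [/andP[bb le]|]; last first.
  by rewrite /betti; case: ifP => // _ /=; rewrite andbT; nlia.
rewrite le size_filter; have leb := leS_leq le.
have [le1 fu0 bb1] := b1_least bb le lt.
rewrite nc_count //; have [e|ne] := eqVneq b b1.
  have iso x : x \in Z S N b -> isolated S b x.
    rewrite mem_Z // => fx; apply: contraT => /(not_isolated_b1 le fx)[].
    by rewrite e ltnn.
  have -> : has (predC (isolated S b)) (Z S N b) = false.
    by apply/hasP => -[x /iso /= ->].
  rewrite (eq_in_count (a2 := predC (pred1 u0))); last by move=> x /iso /= ->.
  rewrite [count (isolated _ _) _](eq_in_count (a2 := predT)); last by move=> x /iso /= ->.
  have fb : is_fact S b u0 by rewrite e.
  have := count_predC (pred1 u0) (Z S N b).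
  rewrite count_uniq_mem ?Z_uniq // mem_Z // fb count_predT /=; nlia.
have lt1 : b1 < b by have := leS_leq le1; nlia.
have [||v fv] := @fact_exists (b - b1); first by nlia.
  by case/andP: le1.
have -> : has (predC (isolated S b)) (Z S N b).
  apply/hasP; exists (vadd u0 v).
    by rewrite mem_Z // -(subnKC (leS_leq le1)); exact: is_factD.
  apply: (@isolated_swap b b1 (b - b1)) => //; nlia.
rewrite addnK; apply: eq_in_count => x; rewrite mem_Z // => fx.
suff -> : x != u0 by rewrite andbT.
apply: contra ne => /eqP ex; case/is_factP: fx => _ <-.
by rewrite ex; case/is_factP: fu0 => _ ->.
Qed.

Definition reduced x := all (fun u => ~~ vle u x) (reducers N).

Lemma reduced_sub x y : reduced x -> reduced (vsub x y).
Proof.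
move=> /allP h; apply/allP => u /h; apply: contra => /vle_trans; apply.
by apply/vleP => i; rewrite ffunE leq_subr.
Qed.

(** A reducer inside [x] could be exchanged as in [isolated_swap]. *)
Lemma isolated_reduced x : is_fact S N x -> isolated S N x -> reduced x.
Proof.
move=> fx iso; apply/allP => u /mem_reducers[lt /mem_reducers_at[bb le fu _ _]].
apply: contraTN iso => lu; rewrite -(vsubK lu).
apply: (@isolated_swap N (wt u) (N - wt u)) => //; try nlia.
by case: (is_fact_sub fx lu).
Qed.

(** Below [x] lies an isolated factorization [w] of a Betti element, and the last hypothesis forces
    [wt w < N]. As [x] is reduced, [w] is not a reducer, which leaves only [u0]. *)
Lemma reduced_vle t x y : leS S t N -> is_fact S t x -> is_fact S t y -> y != x ->
  reduced x -> t < N \/ ~~ isolated S t x -> [/\ vle u0 x, is_fact S b1 u0 & 0 < b1].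
Proof.
move=> tN fx fy ne rx h; have leN := leS_leq tN.
have [w [lw ltN lewt iw bw]] : exists w, [/\ vle w x, wt w < N, leS S (wt w) t,
    isolated S (wt w) w & betti S (wt w)].
  case: h => [lt|iso].
    have [w [lw iw bw]] := isolated_below leN fx fy ne; exists w.
    by have lewt := vle_leS fx lw; split=> //; have := leS_leq lewt; nlia.
  by have [w [? ? ? ? ?]] := not_isolated_below tN fx iso; exists w; split=> //; nlia.
have lewN := leS_trans lewt tN; have [le1 fu0 bb1] := b1_least bw lewN ltN.
have [ew|new] := eqVneq w u0.
  rewrite -ew lw ew; split=> //; apply: betti_gt0 => //.
  by have := leS_leq le1; nlia.
move/allP: rx => /(_ w); rewrite lw reducers_mem // => [/(_ isT)//|].
by case: (is_fact_sub fx lw).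
Qed.

(** If distinct, both would contain [u0]. Removing it keeps them reduced and leads to the smaller
    element [t - b1], where they agree by induction. *)
Lemma reduced_inj t x y : t < N -> leS S t N -> is_fact S t x -> is_fact S t y ->
  reduced x -> reduced y -> x = y.
Proof.
elim/ltn_ind: t x y => t IH x y lt tN fx fy rx ry; apply/eqP; apply: contraT => ne.
have [||lx fu0 b10] := @reduced_vle t x y tN fx fy _ rx; rewrite 1?eq_sym //; first by left.
have [||ly _ _] := @reduced_vle t y x tN fy fx _ ry; rewrite // ; first by left.
have e0 : wt u0 = b1 by case/is_factP: fu0.
have [_] := is_fact_sub fx lx; have [_] := is_fact_sub fy ly; rewrite e0 => fy' fx'.
have le1 : b1 <= t by rewrite -e0; exact: leS_leq (vle_leS fx lx).
case/eqP: ne; rewrite -(vsubK lx) -(vsubK ly).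
rewrite (IH (t - b1) _ (vsub x u0) (vsub y u0)) //; try nlia.
- have le : leS S (t - b1) t.
    rewrite /leS leq_subr /= subKn //; exact: is_fact_S fu0.
  exact: leS_trans le tN.
- exact: reduced_sub.
- exact: reduced_sub.
Qed.

Lemma reduced_exists x : S N -> is_fact S N x -> ~~ isolated S N x ->
  exists2 y, is_fact S N y & reduced y && ~~ isolated S N y.
Proof.
(* Replacing a reducer inside [x] by a factorization of the form [u0 + v] strictly
   increases the total coefficient of [x] on the support of [u0]. *)
move=> SN; pose M x := \sum_(i < N.+1 | u0 i != 0) x i.
have MD a b : M (vadd a b) = M a + M b.
  by rewrite /M -big_split; apply: eq_bigr => i _; rewrite ffunE.
have NN := leS_refl N.
have Mle y : is_fact S N y -> M y <= N.
  move=> fy; case/is_factP: (fy) => _ <-.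
  apply: (@leq_trans (\sum_(i < N.+1) y i)).
    by rewrite [leqRHS](bigID (fun i => u0 i != 0)) /= leq_addr.
  apply: leq_sum => i _; have [->//|yi] := eqVneq (y i) 0.
  by apply: leq_pmulr; exact: is_fact_wt_gt0 fy yi.
(* The induction is on [N - M x], which drops whenever [M] grows because [Mle] bounds [M] by [N]. *)
move: {2}(N - M x) (leqnn (N - M x)) => k; elim/ltn_ind: k x => k IH x lek fx iso.
have [rx|] := boolP (reduced x); first by exists x; rewrite ?rx.
have [lt1 le1 fu0 bb1 _] := not_isolated_b1 NN fx iso.
case/allPn => u uU; rewrite negbK => lu.
have [ltu /mem_reducers_at[bb le fu iu ne]] := mem_reducers uU.
have [le1u _ _] := b1_least bb le ltu.
have le1u' := leS_leq le1u.
have [||v fv] := @fact_exists (wt u - b1); first by nlia.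
  by case/andP: le1u.
have [_ fxu] := is_fact_sub fx lu.
(* A reducer avoids the support of [u0], so its removal does not lower [M]. *)
have dis : ~~ meets u0 u.
  have [lt|] := ltnP b1 (wt u); first by apply: (@isolated_disjoint b1 (wt u)) => //; exact: ltnW.
  move=> ge; have e : b1 = wt u by nlia.
  apply/negP => m; move/(isolatedP _ (ltnW ltu)): iu => /(_ u0).
  by rewrite -e meetsC => /(_ fu0 m) e0; rewrite e0 eqxx in ne.
pose r := vadd v (vsub x u).
have fr : is_fact S (N - b1) r.
  have -> : N - b1 = (wt u - b1) + (N - wt u) by nlia.
  exact: is_factD.
have Mu : M u = 0.
  rewrite /M big1 // => i u0i; apply/eqP; apply: contraNT dis => ui.
  by apply/meetsP; exists i.
have M0 : 0 < M u0.
  have [|i u0i] := is_fact_pos fu0; first by apply: betti_gt0; rewrite // ltnW.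
  by rewrite /M (bigD1 i) //= addn_gt0 lt0n u0i.
have Mx : M x = M (vsub x u) by rewrite -{1}(vsubK lu) MD Mu.
have fN : is_fact S N (vadd u0 r).
  by have := is_factD fu0 fr; rewrite (subnKC (ltnW lt1)).
have := Mle _ fN; rewrite /r !MD -Mx => Mb.
apply: (IH (N - M (vadd u0 r)) _ (vadd u0 r)) => //.
  by rewrite /r !MD -Mx; nlia.
by apply: (@isolated_swap N b1 (N - b1)) => //; nlia.
Qed.

(** The terms match those of [nc_count]: isolated factorizations are all reduced, and if there are
    non-isolated ones, exactly one of them is reduced. For uniqueness, [u0] is removed and
    [reduced_inj] applied at [N - b1]. *)
Lemma count_reduced : S N -> count reduced (Z S N N) = nc S N.
Proof.
move=> SN; have NN := leS_refl N; rewrite nc_count //.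
rewrite -size_filter -(count_predC (isolated S N)) !count_filter; congr (_ + _).
  apply: eq_in_count => x; rewrite mem_Z //= => fx.
  by case iso: (isolated S N x); rewrite // isolated_reduced.
have [/hasP[x]|no] := boolP (has (predC (isolated S N)) (Z S N N)); last first.
  apply/eqP; rewrite eqn0Ngt -has_count; apply: contra no => /hasP[x xZ /andP[iso _]].
  by apply/hasP; exists x.
rewrite mem_Z // => fx iso; have [y fy /andP[ry iy]] := reduced_exists SN fx iso.
rewrite (eq_in_count (a2 := pred1 y)) ?count_uniq_mem ?Z_uniq ?mem_Z ?fy // => z.
rewrite mem_Z //= => fz; apply/andP/eqP => [[iz rz]|->//].
apply/eqP; apply: contraT => ne.
have [|ly fu0 b10] := reduced_vle NN fy fz ne ry; first by right.
have [||lz _ _] := reduced_vle NN fz fy _ rz; rewrite 1?eq_sym //; first by right.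
have e0 : wt u0 = b1 by case/is_factP: fu0.
have [_] := is_fact_sub fy ly; have [_] := is_fact_sub fz lz; rewrite e0 => fz' fy'.
have le1 : b1 <= N by rewrite -e0; exact: leS_leq (vle_leS fy ly).
case/eqP: ne; rewrite -(vsubK ly) -(vsubK lz).
rewrite (@reduced_inj (N - b1) (vsub y u0) (vsub z u0)) //.
- nlia.
- by rewrite /leS leq_subr /= subKn //; exact: is_fact_S fu0.
- exact: reduced_sub.
- exact: reduced_sub.
Qed.

End LocalCount.

(** * Products with the denumerant series as counts of factorizations *)

Section GeneratingFunction.
Variables (S : nat -> bool) (N : nat).
Hypotheses (S0 : S 0) (SD : forall a b, S a -> S b -> S (a + b)%N).

(** The series D of the opening comment, cut off after degree [N]. *)
Definition denumerant : {poly int} := \poly_(i < N.+1) (size (Z S N i))%:R.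

Definition avoids (U : seq (vec N)) x := all (fun u => ~~ vle u x) U.

Lemma vle_vadd_disjoint (u v y : vec N) : ~~ meets u v -> vle v (vadd u y) = vle v y.
Proof.
move=> dis; apply/vleP/vleP => h i; have := h i; rewrite !ffunE; last first.
  by move/leq_trans; apply; rewrite leq_addl.
have [->//|ui] := eqVneq (u i) 0%N; suff -> : v i = 0%N by [].
by apply/eqP; apply: contraNT dis => vi; apply/meetsP; exists i.
Qed.

(** Translation by [u] is the bijection; it preserves [avoids U] because [u] meets no member of
    [U]. *)
Lemma count_vle (U : seq (vec N)) (u : vec N) s : (s <= N)%N ->
    all (fun v => ~~ meets u v) U -> is_fact S (wt u) u ->
  count (fun x => vle u x && avoids U x) (Z S N s) =
    if (s < wt u)%N then 0%N else count (avoids U) (Z S N (s - wt u)).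
Proof.
move=> sN /allP dis fu; case: ltnP => lt.
  apply/eqP; rewrite eqn0Ngt -has_count; apply/hasP => -[x].
  rewrite mem_Z // => fx /andP[/vle_wt le _]; case/is_factP: fx => _ ex.
  by move: lt; rewrite -ex ltnNge le.
have sN' : (s - wt u <= N)%N by rewrite leq_subLR (leq_trans sN) ?leq_addl.
have av y : avoids U (vadd u y) = avoids U y.
  by apply: eq_in_all => v /dis /vle_vadd_disjoint ->.
rewrite -!size_filter -[RHS](size_map (vadd u)).
apply/perm_size/uniq_perm.
- by rewrite filter_uniq ?Z_uniq.
- by rewrite map_inj_uniq ?filter_uniq ?Z_uniq //; exact: vaddI.
move=> x; rewrite mem_filter mem_Z //; apply/andP/mapP.
  case=> /andP[le ax] fx; have [_ fy] := is_fact_sub fx le.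
  exists (vsub x u); last by rewrite vsubK.
  by rewrite mem_filter mem_Z // fy andbT -av vsubK.
case=> y; rewrite mem_filter mem_Z // => /andP[ay fy] ->.
rewrite vle_addr av ay; split=> //.
by rewrite -(subnKC lt); exact: is_factD.
Qed.

(** Each new factor [1 - 'X^(wt u)] subtracts the vectors that avoid the rest of the list but lie
    above [u], by [count_vle]. *)
Lemma coef_denumerant_prod (U : seq (vec N)) s : (s <= N)%N ->
    pairwise (fun u v => ~~ meets u v) U -> all (fun u => is_fact S (wt u) u) U ->
  (denumerant * \prod_(u <- U) (1 - 'X^(wt u)))`_s = (count (avoids U) (Z S N s))%:R.
Proof.
elim: U s => [|u U IH] s sN.
  by rewrite big_nil mulr1 coef_poly ltnS sN count_predT.
rewrite big_cons => /andP[dis pU] /andP[fu fU].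
rewrite mulrCA mulrC mulrBr mulr1 coefB coefMXn IH //.
have -> : count (avoids U) (Z S N s) = (count (avoids (u :: U)) (Z S N s) +
    count (fun x => vle u x && avoids U x) (Z S N s))%N.
  rewrite -size_filter -(count_predC (vle u)) !count_filter addnC.
  by congr (_ + _)%N; apply: eq_count => x //=; rewrite andbC.
rewrite count_vle // natrD; case: ltnP => lt; first by rewrite subr0 addr0.
by rewrite IH ?addrK // leq_subLR (leq_trans sN) ?leq_addl.
Qed.

(** With the unit vectors as the list to avoid, only the zero vector survives. So D inverts the
    product over the generators. *)
Lemma coef_denumerant_mingen s : (s <= N)%N ->
  (denumerant * \prod_(1 <= j < N.+1 | is_mingen S j) (1 - 'X^j))`_s = (s == 0%N)%:R.
Proof.
move=> sN; pose U := [seq unitv i | i : 'I_N.+1 <- enum 'I_N.+1 & is_mingen S i].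
have memU u : u \in U -> exists2 i : 'I_N.+1, is_mingen S i & u = unitv i.
  by case/mapP=> i; rewrite mem_filter => /andP[mi _] ->; exists i.
have -> : \prod_(1 <= j < N.+1 | is_mingen S j) (1 - 'X^j) =
    \prod_(u <- U) (1 - 'X^(wt u)) :> {poly int}.
  rewrite big_map big_filter big_enum_cond /= [in RHS](eq_bigr (fun i : 'I_N.+1 => 1 - 'X^i)).
    rewrite -(big_mkord (is_mingen S) (fun i => 1 - 'X^i)) [RHS]big_mkcond.
    have m0 : is_mingen S 0 = false by rewrite /is_mingen ltnn andbF.
    by rewrite big_ltn // m0 /= mul1r -big_mkcond.
  by move=> i _; rewrite wt_unitv.
rewrite coef_denumerant_prod //; last 2 first.
- apply: pairwise_in_uniq.
    rewrite map_inj_uniq => [|i j e]; first exact/filter_uniq/enum_uniq.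
    by apply: val_inj; rewrite /= -(wt_unitv i) e wt_unitv.
  move=> u v /memU[i _ ->] /memU[j _ ->]; apply: contra => /meetsP[k].
  rewrite !ffunE; case: (eqVneq k i) => [<-|_ []//].
  by case: (eqVneq k j) => [<-|_ []//].
- by apply/allP => u /memU[i mi ->]; rewrite wt_unitv is_fact_unitv.
congr (_%:R); have [->|s0] := eqVneq s 0%N.
  rewrite (eq_in_count (a2 := pred1 [ffun=> 0%N])) ?count_uniq_mem ?Z_uniq //.
    by rewrite mem_Z // is_fact0 eqxx.
  move=> x; rewrite mem_Z //= is_fact0 => /eqP ->; rewrite eqxx.
  by apply/allP => u /memU[i _ ->]; rewrite vle_unitv ffunE.
apply/eqP; rewrite eqn0Ngt -has_count; apply/hasP => -[x].
rewrite mem_Z // => fx /allP h; have [|i xi] := is_fact_pos fx; first by rewrite lt0n.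
have /h : unitv i \in U.
  apply: map_f; rewrite mem_filter mem_enum andbT.
  by case/is_factP: fx => /(_ i xi).
by rewrite vle_unitv xi.
Qed.

(** The expected value of the factor with index [j] in K, replaced by 1 where it cannot influence
    the coefficient of degree [N]. *)
Definition local_factor j : {poly int} :=
  if S j && leS S j N then (1 - 'X^j) ^+ (nc S j - 1) else 1.

Lemma prod_reducers (b1 : nat) (u0 : vec N) :
    (forall b, betti S b -> leS S b N -> (b < N)%N ->
       [/\ leS S b1 b, is_fact S b1 u0 & betti S b1]) ->
  \prod_(u <- reducers S u0 N) (1 - 'X^(wt u)) = \prod_(1 <= j < N) local_factor j.
Proof.
move=> b1_least; rewrite /reducers big_flatten big_map /=.
rewrite [LHS]big_seq [RHS]big_seq; apply: eq_bigr => j.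
rewrite mem_index_iota => /andP[_ jN].
rewrite (eq_big_seq (fun=> 1 - 'X^j)); last first.
  by move=> u /mem_reducers_at[_ _ /is_factP[_ ->]].
rewrite big_const_seq count_predT iter_mulr_1 (size_reducers_at S0 SD b1_least) //.
rewrite /local_factor; case: ifP => [le|]; last by rewrite andbF expr0.
rewrite andbT; case: ifP => // nS.
have [/(betti_S S0 SD (leS_leq le))|] := boolP (betti S j); first by rewrite nS.
by rewrite /betti -leqNgt => /eqP->.
Qed.

(** In a chain the numerically smallest Betti element is also the [leS]-minimum; it serves as [b1],
    with any factorization of it as [u0]. *)
Lemma denumerant_local :
    S N ->
    (forall b c, betti S b -> betti S c -> leS S b N -> leS S c N ->
       leS S b c \/ leS S c b) ->
  (denumerant * \prod_(1 <= j < N) local_factor j)`_N = (nc S N)%:R.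
Proof.
move=> SN chain.
suff [b1 [u0 b1_least]] : exists b1 (u0 : vec N), forall b, betti S b -> leS S b N ->
    (b < N)%N -> [/\ leS S b1 b, is_fact S b1 u0 & betti S b1].
  rewrite -(prod_reducers b1_least) coef_denumerant_prod //.
  - by rewrite (count_reduced S0 SD b1_least SN).
  - exact: reducers_pairwise.
  - by apply/allP => u /mem_reducers[_ /mem_reducers_at[]].
pose P b := [&& betti S b, leS S b N & (b < N)%N].
have [ex|no] := boolP [exists b : 'I_N, P b]; last first.
  (* With no Betti element strictly below [N], these are dummy values. *)
  exists 0%N, [ffun=> 0%N] => b bb le lt; case/negP: no.
  by apply/existsP; exists (Ordinal lt); rewrite /P bb le.
have exP : exists b, P b by case/existsP: ex => b ?; exists b.
case: (ex_minnP exP) => b1 /and3P[bb1 le1 lt1] min1.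
have [u0 fu0 _] := betti_facts [ffun=> 0%N] (ltnW lt1) bb1.
exists b1, u0 => b bb le lt; split=> //.
have leb : (b1 <= b)%N by apply: min1; rewrite /P bb le.
have [//|/leS_leq geb] := chain _ _ bb1 bb le1 le.
by have -> : b1 = b; [apply/eqP; rewrite eqn_leq leb|exact: leS_refl].
Qed.

End GeneratingFunction.

(** * Arithmetic of power series modulo ['X^N.+1] *)

Definition eq_upto N (p q : {poly int}) := forall i, (i <= N)%N -> p`_i = q`_i.

Lemma eq_uptoM N p q p' q' : eq_upto N p q -> eq_upto N p' q' ->
  eq_upto N (p * p') (q * q').
Proof.
move=> h h' i iN; rewrite !coefM; apply: eq_bigr => j _; rewrite h ?h' //.
  by apply: leq_trans iN; apply: leq_subr.
by apply: leq_trans iN; rewrite -ltnS.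
Qed.

Lemma eq_upto_trans N p q r : eq_upto N p q -> eq_upto N q r -> eq_upto N p r.
Proof. by move=> h h' i iN; rewrite h ?h'. Qed.

Lemma eq_upto_sym N p q : eq_upto N p q -> eq_upto N q p.
Proof. by move=> h i /h. Qed.

Lemma eq_uptoX N p q n : eq_upto N p q -> eq_upto N (p ^+ n) (q ^+ n).
Proof. by move=> h; elim: n => [|n IH] //; rewrite !exprS; exact: eq_uptoM. Qed.

Lemma eq_upto_prod N (r : seq nat) (F G : nat -> {poly int}) :
    {in r, forall j, eq_upto N (F j) (G j)} ->
  eq_upto N (\prod_(j <- r) F j) (\prod_(j <- r) G j).
Proof.
elim: r => [|j r IH] h; first by rewrite !big_nil.
rewrite !big_cons; apply: eq_uptoM; first by apply: h; rewrite mem_head.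
by apply: IH => k kr; apply: h; rewrite inE kr orbT.
Qed.

Lemma eq_upto_cancel N (a b p q : {poly int}) : eq_upto N (b * a) 1 ->
  eq_upto N (a * p) (a * q) -> eq_upto N p q.
Proof.
move=> h1 h2; have e r : eq_upto N (b * (a * r)) r.
  by rewrite mulrA -[X in eq_upto _ _ X]mul1r; apply: eq_uptoM.
apply: eq_upto_trans (e q); apply: eq_upto_trans (eq_upto_sym (e p)) _.
exact: eq_uptoM.
Qed.

(* Modulo ['X^N.+1], [qfactor N j p q] is [(1 - 'X^j) ^ (q - p)]: the truncated
   geometric series stands for the inverse of [1 - 'X]. *)
Definition qfactor N j p q : {poly int} :=
  ((1 - 'X) ^+ q * (\sum_(k < N.+1) 'X^k) ^+ p) \Po 'X^j.

Lemma comp_1subX j : (1 - 'X) \Po 'X^j = 1 - 'X^j :> {poly int}.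
Proof. by rewrite rmorphB rmorph1 /= comp_polyX. Qed.

Lemma geometric_upto N : eq_upto N ((1 - 'X) * \sum_(k < N.+1) 'X^k) 1.
Proof.
move=> i iN; rewrite -opprB mulNr -subrX1 opprB coefB coefXn.
by rewrite eqn_leq ltnNge iN andbF subr0.
Qed.

Lemma comp_upto N p q j : (0 < j)%N -> eq_upto N p q ->
  eq_upto N (p \Po 'X^j) (q \Po 'X^j).
Proof.
move=> j0 h i iN; rewrite !coef_comp_poly_Xn //; case: ifP => // _; apply: h.
by apply: leq_trans (leq_div _ _) iN.
Qed.

(** Modulo ['X^N.+1], the power [p] of the geometric sum cancels [p] of the [p + m] factors
    [1 - 'X]; then ['X^j] is substituted. *)
Lemma qfactor_upto N j p m : (0 < j)%N ->
  eq_upto N (qfactor N j p (p + m)) ((1 - 'X^j) ^+ m).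
Proof.
move=> j0; rewrite -comp_1subX -rmorphXn; apply: comp_upto => //.
rewrite exprD mulrAC -exprMn -[X in eq_upto _ _ X]mul1r.
apply: eq_uptoM => //; rewrite -[X in eq_upto _ _ X](expr1n _ p).
apply: eq_uptoX; exact: geometric_upto.
Qed.

Lemma mul_qfactor N j p q : (0 < j)%N ->
  eq_upto N ((1 - 'X^j) ^+ p * qfactor N j p q) ((1 - 'X^j) ^+ q).
Proof.
move=> j0; rewrite -comp_1subX -[X in X * _]rmorphXn -rmorphM /= mulrA -exprD comp_1subX.
exact: qfactor_upto.
Qed.

Lemma coef_qfactor_dvd N j p q i : (0 < j)%N -> (qfactor N j p q)`_i != 0 -> (j %| i)%N.
Proof. by move=> j0; rewrite coef_comp_poly_Xn //; case: ifP; rewrite ?eqxx. Qed.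

Lemma coef01_exp (p : {poly int}) n : p`_0 = 1 ->
  (p ^+ n)`_0 = 1 /\ (p ^+ n)`_1 = p`_1 *+ n.
Proof.
move=> p0; elim: n => [|n [IH0 IH1]]; first by rewrite expr0 !coef1.
rewrite exprS !coefM !big_ord_recl !big_ord0 /= ?subnn ?subn0 /bump /= p0 IH0 IH1.
by rewrite !mulr1 !mul1r !addr0 mulrSr.
Qed.

Lemma coef_sum_Xn N (P : pred nat) k : (k <= N)%N ->
  (\sum_(i < N.+1 | P i) 'X^i : {poly int})`_k = (P k)%:R.
Proof.
move=> kN; rewrite coef_sum (bigID (fun j : 'I_N.+1 => (j : nat) == k)) /=.
rewrite [X in _ + X]big1 ?addr0; last first.
  by move=> j /andP[_ ne]; rewrite coefXn eq_sym (negbTE ne).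
have [Pk|nPk] := boolP (P k); last first.
  by rewrite big1 // => j /andP[Pj /eqP ej]; rewrite ej (negbTE nPk) in Pj.
rewrite (big_pred1 (Ordinal (kN : k < N.+1)%N)) ?coefXn ?eqxx // => j.
by rewrite /= -[RHS]val_eqE /=; case: eqP => [->|]; rewrite ?andbF // Pk.
Qed.

Lemma coef_qfactor N j p q : (0 < j)%N -> (0 < N)%N ->
  (qfactor N j p q)`_0 = 1 /\ (qfactor N j p q)`_j = p%:Z - q%:Z.
Proof.
move=> j0 N0; rewrite !coef_comp_poly_Xn // dvdn0 dvdnn div0n divnn j0.
have a0 : (1 - 'X : {poly int})`_0 = 1 by rewrite coefB coef1 coefX subr0.
have a1 : (1 - 'X : {poly int})`_1 = -1 by rewrite coefB coef1 coefX sub0r.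
have b k : (k <= N)%N -> (\sum_(k < N.+1) 'X^k : {poly int})`_k = 1.
  by move=> kN; rewrite (@coef_sum_Xn N predT).
move: (\sum_(k < N.+1) 'X^k) b => g b.
have [q0 q1] := coef01_exp q a0; have [p0 p1] := coef01_exp p (b 0 (leq0n N)).
rewrite !coefM !big_ord_recl !big_ord0 /= ?subnn ?subn0 /bump /= q0 p0 q1 p1 a1 (b _ N0).
by split; rewrite ?mulr1 ?mul1r ?addr0 // mulNrn !natz.
Qed.

(* Equality in the quotient of the ring of series supported on [S] by its ideal of
   series with no term of degree [<=_S d]. *)
Definition eq_local (S : nat -> bool) d (p q : {poly int}) :=
  forall i, (i <= d)%N -> if S i then leS S i d -> p`_i = q`_i else p`_i = 0 /\ q`_i = 0.

(** * Series supported on [S], compared below an element in the order of [S] *)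

Section Local.
Variable S : nat -> bool.
Hypotheses (S0 : S 0) (SD : forall a b, S a -> S b -> S (a + b)%N).

(** Only splittings of [i] into two elements of [S] contribute, and both parts are then below [i],
    hence below [d], in the order of [S]. *)
Lemma eq_localM d p q p' q' : eq_local S d p q -> eq_local S d p' q' ->
  eq_local S d (p * p') (q * q').
Proof.
move=> h h' i le; rewrite !coefM.
have hj (j : 'I_i.+1) : (j <= i)%N by rewrite -ltnS.
have jd (j : 'I_i.+1) : (j <= d)%N by apply: leq_trans le.
have ijd (j : 'I_i.+1) : (i - j <= d)%N by apply: leq_trans le; apply: leq_subr.
case: ifP => Si.
  move=> led; apply: eq_bigr => j _.
  have := h _ (jd j); case: ifP => [Sj e|_ [-> ->]]; last by rewrite !mul0r.
  have := h' _ (ijd j); case: ifP => [Sij e'|_ [-> ->]]; last by rewrite !mulr0.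
  rewrite e ?e' //; apply: leS_trans led; rewrite ?leS_leq //.
    by rewrite /leS leq_subr subKn.
  by rewrite /leS hj.
split; apply: big1 => j _.
  have := h _ (jd j); case: ifP => [Sj _|_ [-> _]]; last by rewrite mul0r.
  have := h' _ (ijd j); case: ifP => [Sij _|_ [-> _]]; last by rewrite mulr0.
  by have := SD Sj Sij; rewrite subnKC // Si.
have := h _ (jd j); case: ifP => [Sj _|_ [_ ->]]; last by rewrite mul0r.
have := h' _ (ijd j); case: ifP => [Sij _|_ [_ ->]]; last by rewrite mulr0.
by have := SD Sj Sij; rewrite subnKC // Si.
Qed.

Lemma eq_local1 d : eq_local S d 1 1.
Proof. by move=> i _; case: ifP => // Si; rewrite coef1; case: eqP Si => // ->; rewrite S0. Qed.

Lemma eq_local_prod d (r : seq nat) (F G : nat -> {poly int}) :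
    {in r, forall j, eq_local S d (F j) (G j)} ->
  eq_local S d (\prod_(j <- r) F j) (\prod_(j <- r) G j).
Proof.
elim: r => [|j r IH] h; first by rewrite !big_nil; exact: eq_local1.
rewrite !big_cons; apply: eq_localM; first by apply: h; rewrite mem_head.
by apply: IH => k kr; apply: h; rewrite inE kr orbT.
Qed.

Lemma eq_local_upto d p p' q q' : eq_upto d p p' -> eq_upto d q q' ->
  eq_local S d p' q' -> eq_local S d p q.
Proof. by move=> h h' hl i le; rewrite h ?h' //; exact: hl. Qed.

Lemma S_dvd j i : S j -> (j %| i)%N -> S i.
Proof.
move=> Sj /dvdnP[k ->]; elim: k => [|k IH] //; rewrite mulSn; exact: SD.
Qed.

(** Reflexivity of [eq_local] is a condition on the support; here the exponents are multiples of [j]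
    and so lie in [S]. *)
Lemma qfactor_local N d j p q : (0 < j)%N -> S j ->
  eq_local S d (qfactor N j p q) (qfactor N j p q).
Proof.
move=> j0 Sj i _; case: ifP => // Si.
have -> : (qfactor N j p q)`_i = 0; last by [].
by apply: contraFeq Si => /(coef_qfactor_dvd j0); exact: S_dvd.
Qed.

(** A positive exponent [i] that occurs is a multiple of [j], so [i] below [d] would put [j] below
    [d] as well. *)
Lemma qfactor_local1 N d j p q : (0 < j)%N -> (0 < N)%N -> S j -> ~~ leS S j d ->
  eq_local S d (qfactor N j p q) 1.
Proof.
move=> j0 N0 Sj nle i le; rewrite coef1.
have [->|i0] := eqVneq i 0%N.
  by rewrite S0; have [->] := coef_qfactor p q j0 N0.
have [->|/(coef_qfactor_dvd j0) ji] := eqVneq (qfactor N j p q)`_i 0.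
  by case: ifP.
rewrite (S_dvd Sj ji) => led; case/negP: nle.
apply: (leS_trans SD _ led); rewrite /leS.
rewrite dvdn_leq ?lt0n //=; apply: (S_dvd Sj); exact: dvdn_sub.
Qed.

Lemma denumerant_local_refl d : eq_local S d (denumerant S d) (denumerant S d).
Proof.
move=> i le; case: ifP => // Si; rewrite coef_poly ltnS le.
suff -> : Z S d i = [::] by [].
apply/eqP; rewrite -size_eq0 eqn0Ngt -has_predT; apply/hasP => -[x].
by rewrite mem_Z // => /(is_fact_S S0 SD); rewrite Si.
Qed.

Lemma nc_gt0 s : S s -> (0 < nc S s)%N.
Proof.
move=> Ss; have [x fx] := fact_exists (leqnn s) Ss.
have [y yf _] := is_fact_exists (leqnn s) fx.
have csym := sym_connect_sym (@nabla_sym S _ _ (leqnn s)).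
apply/card_gt0P; exists (fingraph.root (nabla_rel S s) y); rewrite inE /= roots_root //=.
by have := closed_connect (@nabla_closed S s) (connect_root (nabla_rel S s) y) => /= <-.
Qed.

(** A generator [k < b] in a factorization of [b] would split [b] inside [S]. Hence the unit vector
    is the only factorization. *)
Lemma mingen_not_betti b : is_mingen S b -> ~~ betti S b.
Proof.
move=> mb; apply/negP => bb; pose i := @ord_max b.
have [x fx] := betti_facts (unitv i) (leqnn b) bb; case/eqP; apply/esym.
have [hx _] := is_factP _ _ _ fx.
have [_ b0 /existsPn nb] := and3P mb.
apply: (vle_wt_eq fx); last by rewrite wt_unitv.
have [k xk] := is_fact_pos fx b0.
have lk : vle (unitv k) x by rewrite vle_unitv.
suff -> : i = k by [].
apply: val_inj => /=; apply/eqP; rewrite eqn_leq -[(k <= b)%N]ltnS ltn_ord andbT leqNgt.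
apply/negP => kb; have [Sk k0 _] := and3P (hx _ xk).
have /negP := nb (Ordinal kb); apply; rewrite /= k0 Sk /=.
have [_] := is_fact_sub fx lk; rewrite wt_unitv; exact: is_fact_S.
Qed.

(** * The exponents of K: their recursion and their values *)

Variable e : nat -> int.
Hypothesis eP : is_cyclotomic_exponents S e.

(** [Kexp j] is the exponent g_j of the opening comment, written as a difference of naturals. The
    term [j == 1] accounts for the factor 1 - x of P_S, and [is_mingen S j] for the division by
    D. *)
Definition neg_exp j : nat := ((if (e j < 0)%R then absz (e j) else 0) + (j == 1))%N.
Definition pos_exp j : nat := ((if (0 < e j)%R then absz (e j) else 0) + is_mingen S j)%N.
Definition Kexp j : int := (pos_exp j)%:Z - (neg_exp j)%:Z.
Notation factor N j := (qfactor N j (neg_exp j) (pos_exp j)).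

Lemma KexpE j : Kexp j = e j + (is_mingen S j)%:Z - (j == 1%N)%:Z.
Proof.
rewrite /Kexp /pos_exp /neg_exp !PoszD.
have ej : e j = (if 0 < e j then absz (e j) else 0%N)%:Z -
    (if e j < 0 then absz (e j) else 0%N)%:Z.
  by case: (ltrgtP (e j) 0) => h; lia.
by rewrite opprD addrACA -ej addrA.
Qed.

Lemma prod_expD (r : seq nat) (P Q : pred nat) (c : nat -> nat) :
  \prod_(j <- r) (1 - 'X^j) ^+ ((if P j then c j else 0) + Q j)%N =
  (\prod_(j <- r | P j) (1 - 'X^j) ^+ c j) * \prod_(j <- r | Q j) (1 - 'X^j) :> {poly int}.
Proof.
rewrite [X in _ = X * _]big_mkcond [X in _ = _ * X]big_mkcond -big_split.
apply: eq_bigr => j _ /=; rewrite exprD.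
by case: (P j); case: (Q j).
Qed.

Lemma hilbert_series_upto N : (0 < N)%N ->
  eq_upto N (\sum_(i < N.+1 | S i) 'X^i)
    (denumerant S N * \prod_(1 <= j < N.+1) factor N j).
Proof.
move=> N0.
pose A : {poly int} := \prod_(1 <= j < N.+1) (1 - 'X^j) ^+ neg_exp j.
pose B : {poly int} := \prod_(1 <= j < N.+1) (1 - 'X^j) ^+ pos_exp j.
have pos j : j \in index_iota 1 N.+1 -> (0 < j)%N by rewrite mem_index_iota => /andP[].
have hAF : eq_upto N (A * \prod_(1 <= j < N.+1) factor N j) B.
  by rewrite -big_split; apply: eq_upto_prod => j /pos j0; exact: mul_qfactor.
(* The given product inverts [A] modulo ['X^N.+1], so both sides may be multiplied by [A], which
   clears the negative exponents. *)
apply: (@eq_upto_cancel N A (\prod_(1 <= j < N.+1) qfactor N j (neg_exp j) 0)).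
  rewrite mulrC -big_split.
  apply: (@eq_upto_trans _ _ (\prod_(1 <= j < N.+1) 1)); last by rewrite big1_eq.
  by apply: eq_upto_prod => j /pos j0; have := @mul_qfactor N j (neg_exp j) 0 j0.
have eA : A * (\sum_(i < N.+1 | S i) 'X^i) = semigroup_poly_trunc S N *
       \prod_(1 <= j < N.+1 | e j < 0) (1 - 'X^j) ^+ absz (e j).
  rewrite /A /neg_exp prod_expD /semigroup_poly_trunc.
  have -> : \prod_(1 <= j < N.+1 | j == 1%N) (1 - 'X^j) = 1 - 'X :> {poly int}.
    by rewrite big_nat1_eq /= ltnS N0 expr1.
  by rewrite mulrC mulrA mulrC mulrCA mulrA [X in X * _]mulrC.
have eB : B * denumerant S N = denumerant S N *
    (\prod_(1 <= j < N.+1 | is_mingen S j) (1 - 'X^j)) *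
    \prod_(1 <= j < N.+1 | 0 < e j) (1 - 'X^j) ^+ absz (e j).
  by rewrite /B /pos_exp prod_expD -mulrA mulrC [X in _ * X]mulrC.
apply: (@eq_upto_trans _ _ (B * denumerant S N)); last first.
  rewrite mulrCA [X in eq_upto _ X]mulrC.
  by apply: eq_uptoM => //; apply: eq_upto_sym.
rewrite eA eB; apply: eq_upto_trans (@eP N) _.
rewrite -[X in eq_upto _ X]mul1r; apply: eq_uptoM => // i iN.
by rewrite coef_denumerant_mingen // coef1.
Qed.

Lemma coef_mul_ends N (p q : {poly int}) : (0 < N)%N ->
    (forall i, (0 < i < N)%N -> q`_i = 0) ->
  (p * q)`_N = p`_N * q`_0 + p`_0 * q`_N.
Proof.
case: N => // N _ h; rewrite coefM big_ord_recr big_ord_recl /= subn0 subnn addrC.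
rewrite big1 ?addr0 // => i _; rewrite h ?mulr0 //=; rewrite /bump /=.
by have := ltn_ord i; lia.
Qed.

(** Up to degree [N] the last factor is 1 minus [Kexp N] times ['X^N], and the product of D with the
    earlier factors has constant term 1. *)
Lemma Kexp_rec N : (0 < N)%N ->
  Kexp N = (denumerant S N * \prod_(1 <= j < N) factor N j)`_N - (S N)%:R.
Proof.
move=> N0; have := hilbert_series_upto N0; rewrite big_nat_recr //= mulrA.
set p := denumerant S N * _ => h.
have [q0 qN] := coef_qfactor (neg_exp N) (pos_exp N) N0 N0.
have p0 : p`_0 = 1.
  by have := h 0 (leq0n N); rewrite coef_sum_Xn // S0 coefM big_ord1 subnn q0 mulr1 => <-.
have := h N (leqnn N); rewrite coef_sum_Xn // coef_mul_ends //.
  by rewrite q0 qN p0 mulr1 mul1r /Kexp => ->; rewrite opprD addrA subrr add0r opprB.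
move=> i /andP[i0 iN]; apply/eqP; apply: contraLR iN => /(coef_qfactor_dvd N0).
by move/(dvdn_leq i0); rewrite -leqNgt.
Qed.

Lemma factor_upto N j m : (0 < j)%N -> Kexp j = m%:Z ->
  eq_upto N (factor N j) ((1 - 'X^j) ^+ m).
Proof.
move=> j0 h; have -> : pos_exp j = (neg_exp j + m)%N by move: h; rewrite /Kexp; lia.
exact: qfactor_upto.
Qed.

(** By induction the earlier factors with index outside [S] are trivial, so the product in the
    recursion is supported on [S]. *)
Lemma Kexp_S j : (0 < j)%N -> ~~ S j -> Kexp j = 0.
Proof.
elim/ltn_ind: j => N IH N0 nS; rewrite Kexp_rec // (negbTE nS) subr0.
set p := _ * _; suff /(_ N (leqnn N)) : eq_local S N p p by rewrite (negbTE nS) => -[].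
apply: eq_localM; first exact: denumerant_local_refl.
apply: eq_local_prod => j; rewrite mem_index_iota => /andP[j0 jN].
have [Sj|nSj] := boolP (S j); first exact: qfactor_local.
have h := @factor_upto N j 0 j0 (IH j jN j0 nSj).
exact: (eq_local_upto h h (@eq_local1 N)).
Qed.

(** Each earlier factor may be replaced by [local_factor]: outside [S] by [Kexp_S], for [j] not
    below [d] by [qfactor_local1], and for [j] below [d] by induction, since the chain condition
    passes down. Then [denumerant_local] evaluates the recursion. *)
Lemma Kexp_nc d : (0 < d)%N -> S d ->
    (forall b c, betti S b -> betti S c -> leS S b d -> leS S c d ->
       leS S b c \/ leS S c b) ->
  Kexp d = (nc S d)%:Z - 1.
Proof.
elim/ltn_ind: d => d IH d0 Sd chain; rewrite Kexp_rec // Sd; congr (_ - _).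
rewrite -(natz (nc S d)) -(denumerant_local S0 SD Sd chain).
set p := _ * _; set q := _ * _.
suff /(_ d (leqnn d)) : eq_local S d p q by rewrite Sd; apply; exact: leS_refl.
apply: eq_localM; first exact: denumerant_local_refl.
apply: eq_local_prod => j; rewrite mem_index_iota /local_factor => /andP[j0 jd].
have [Sj|nSj] := boolP (S j); last first.
  have h := @factor_upto d j 0 j0 (Kexp_S j0 nSj).
  by apply: (eq_local_upto h _ (@eq_local1 d)).
have [led|nle] := boolP (leS S j d); last exact: qfactor_local1.
have ej : Kexp j = (nc S j - 1)%N%:Z.
  rewrite IH //; first by have := nc_gt0 Sj; lia.
  by move=> b c bb bc leb lec; apply: chain => //; apply: leS_trans led.
have h := factor_upto (N := d) j0 ej.
have hp : eq_upto d (factor d j) (factor d j) by [].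
by apply: (eq_local_upto hp (eq_upto_sym h)); exact: qfactor_local.
Qed.

Lemma exp_nc d : (1 < d)%N -> S d -> ~~ is_mingen S d ->
    (forall b c, betti S b -> betti S c -> leS S b d -> leS S c d ->
       leS S b c \/ leS S c b) ->
  e d = (nc S d)%:Z - 1.
Proof.
move=> d1 Sd nm chain; rewrite -Kexp_nc //; last exact: ltnW.
by rewrite KexpE (negbTE nm) gtn_eqF // addr0 subr0.
Qed.

Lemma E_set_S d : E_set S e d -> S d.
Proof.
case/and3P=> d1 ed nm; apply: contraT => nS; case/eqP: ed.
have := Kexp_S (ltnW d1) nS.
by rewrite KexpE (negbTE nm) gtn_eqF // addr0 subr0.
Qed.

Lemma betti_nonmingen b : betti S b -> [/\ (1 < b)%N, S b & ~~ is_mingen S b].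
Proof.
move=> bb; have Sb := betti_S S0 SD (leqnn b) bb.
have nm : ~~ is_mingen S b by apply: contraL bb; exact: mingen_not_betti.
split=> //; have := betti_gt0 (leqnn b) bb.
(* Only [b = 1] remains, and 1 is a minimal generator as soon as it lies in [S]. *)
case: b {bb} Sb nm => [|[|b]] // S1; rewrite /is_mingen S1 /= negbK.
by case/existsP => a; case: a => -[].
Qed.

End Local.

(** * Comparison of the two U-sets *)

Unset Implicit Arguments.

Theorem theorem1p2 (S : nat -> bool) (e : nat -> int) :
  is_numerical_semigroup S -> is_cyclotomic_exponents S e ->
  (forall b : nat, U S (betti S) b <-> U S (E_set S e) b) /\
  (forall b : nat, U S (betti S) b -> e b = (nc S b)%:Z - 1).
Proof.
case=> S0 SD _ eP.
have formula b : U S (betti S) b -> e b = (nc S b)%:Z - 1.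
  case=> bb chain; have [b1 Sb nm] := betti_nonmingen S0 SD bb.
  exact: (exp_nc S0 SD eP).
have UbettiE b : U S (betti S) b -> E_set S e b.
  move=> Ub; have [b1 _ nm] := betti_nonmingen S0 SD (proj1 Ub).
  rewrite /E_set b1 nm andbT /= formula //.
  by have := proj1 Ub; rewrite /betti; lia.
split=> // b; split.
  move=> Ub; split; first exact: UbettiE.
  (* Below [b] the chain condition also holds for [d], so [e d] is [nc S d - 1]; it is nonzero and
     [nc S d] is positive, which makes [d] a Betti element. *)
  have bettiE d : E_set S e d -> leS S d b -> betti S d.
    move=> Ed led; have Sd := E_set_S S0 SD eP Ed; have [d1 ed nm] := and3P Ed.
    have ed' : e d = (nc S d)%:Z - 1.
      apply: (exp_nc S0 SD eP) => // y z by_ bz ley lez.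
      by apply: (proj2 Ub) => //; apply: (leS_trans SD _ led).
    have := nc_gt0 Sd; move: ed; rewrite ed' /betti; lia.
  by move=> y z Ey Ez ley lez; apply: (proj2 Ub) => //; exact: bettiE.
case=> Eb chainE.
(* By induction, Betti elements strictly below [s] belong to the U-set of the Betti elements. They
   therefore lie in [E_set S e], whose elements below [b] form a chain. *)
have chain s : leS S s b -> forall y z, betti S y -> betti S z ->
    leS S y s -> leS S z s -> leS S y z \/ leS S z y.
  elim/ltn_ind: s => s IH sb y z by_ bz ys zs.
  have [->|ney] := eqVneq y s; first by right.
  have [->|nez] := eqVneq z s; first by left.
  have below w : betti S w -> leS S w s -> w != s -> E_set S e w.
    move=> bw ws ne; apply: UbettiE; split=> //; apply: IH.
      by rewrite ltn_neqAle ne (leS_leq ws).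
    exact: (leS_trans SD ws sb).
  apply: chainE; [exact: below|exact: below|..].
    exact: (leS_trans SD ys sb).
  exact: (leS_trans SD zs sb).
have [b1 eb nm] := and3P Eb; have Sb := E_set_S S0 SD eP Eb.
have cb := chain b (leS_refl S0 b); split=> //.
have := exp_nc S0 SD eP b1 Sb nm cb; have := nc_gt0 Sb.
by move: eb; rewrite /betti; lia.
Qed.
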